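(* Let $x_1\in\mathrm{dom}(r)$ be such that $F(x_1)-\inf_{x\in\mathbb{R}^d}F(x)\le\Delta$ for some $\Delta>0$. Let $\gamma>0$, $c>0$, and suppose there is a stochastic algorithm $\mathcal{A}$ that, when applied to $F^\gamma_{x_k}$ at stage $k$, finds a solution $x_{k+1}$ satisfying $$\mathbb{E}\Big[F^{\gamma}_{x_k}(x_{k+1})-\min_{x\in\mathbb{R}^d}F^{\gamma}_{x_k}(x)\Big]\le\frac{c}{k}.$$ Then with a total of $K$ stages (i.e. $k=1,\dots,K$), $$\mathbb{E}\big[\|G_\gamma(x_\tau)\|^2\big]\le\frac{2\gamma\Delta}{K}+\frac{2\gamma c(1+\log K)}{K},$$ where $\tau\in\{1,\dots,K\}$ is uniformly sampled.
   Context: Problem: $\min_{x\in\mathbb{R}^d}F(x):=g(x)+r(x)-h(x)$, where $g,h:\mathbb{R}^d\to\mathbb{R}$ are lower-semicontinuous convex functions and $r:\mathbb{R}^d\to\mathbb{R}\cup\{+\infty\}$ is a proper lower-semicontinuous convex function. $\|\cdot\|$ is the Euclidean norm. When $\partial h(z)$ is used as a vector it denotes a fixed chosen subgradient of $h$ at $z$. For $\gamma>0$ and $z\in\mathbb{R}^d$ define $$F^{\gamma}_{z}(x)=g(x)+r(x)-\big(h(z)+\partial h(z)^{\top}(x-z)\big)+\tfrac{\gamma}{2}\|x-z\|^2,$$ $P_\gamma(z)=\arg\min_{x}F^\gamma_z(x)$ and $G_\gamma(z)=\gamma(z-P_\gamma(z))$. Stagewise algorithm: start from $x_1\in\mathrm{dom}(r)$;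 for $k=1,\dots,K$ let $x_{k+1}$ be the (random) output of $\mathcal{A}$ applied to $F^\gamma_{x_k}$. The index $\tau$ is sampled independently of the algorithm's randomness. *)

(* Defs.v *)
From HB Require Import structures.
From mathcomp Require Import all_boot all_order all_algebra.
From mathcomp Require Import all_classical all_reals all_analysis.

Set Implicit Arguments.
Unset Strict Implicit.
Unset Printing Implicit Defensive.

Import Order.TTheory GRing.Theory Num.Theory.
Import numFieldNormedType.Exports.

Local Open Scope classical_set_scope.
Local Open Scope ring_scope.

(* The library norm on 'rV[R]_d is the max norm; the Euclidean norm is enorm. *)
Definition dotv (R : realType) (d : nat) (u v : 'rV[R]_d) : R :=
  \sum_(i < d) u 0 i * v 0 i.

Definition enorm (R : realType) (d : nat) (u : 'rV[R]_d) : R :=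
  Num.sqrt (dotv u u).

Section convex_analysis.
Context (R : realType) (d : nat).
Local Notation E := 'rV[R]_d.
Local Open Scope ereal_scope.

Definition econvex (r : E -> \bar R) : Prop :=
  forall (x y : E) (t : R), (0 <= t <= 1)%R ->
    r (t *: x + (1 - t) *: y)%R <= t%:E * r x + (1 - t)%:E * r y.

Definition edom (r : E -> \bar R) : set E := [set x | r x < +oo].

Definition eproper (r : E -> \bar R) : Prop :=
  (forall x, r x != -oo) /\ edom r !=set0.

Definition subdifferential (h : E -> R) (z : E) : set E :=
  [set v | forall x, (h z + dotv v (x - z) <= h x)%R].

Definition argmin (f : E -> \bar R) : set E := [set p | forall x, f p <= f x].

End convex_analysis.

Section difference_of_convex.
Context (R : realType) (d : nat).
Local Notation E := 'rV[R]_d.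
Local Open Scope ereal_scope.

Definition objective (g h : E -> R) (r : E -> \bar R) (x : E) : \bar R :=
  (g x)%:E + r x - (h x)%:E.

(* dh is the chosen selection of subgradients of h. *)
Definition model (g h : E -> R) (r : E -> \bar R) (dh : E -> E) (gamma : R)
    (z x : E) : \bar R :=
  (g x)%:E + r x - (h z + dotv (dh z) (x - z))%:E
  + (gamma / 2 * enorm (x - z) ^+ 2)%:E.

(* The minimizer of a strongly convex function is unique; xget only supplies
   the value 0 in case there is no minimizer. *)
Definition prox_point (g h : E -> R) (r : E -> \bar R) (dh : E -> E)
    (gamma : R) (z : E) : E :=
  xget 0%R (argmin (model g h r dh gamma z)).

Definition prox_grad (g h : E -> R) (r : E -> \bar R) (dh : E -> E)
    (gamma : R) (z : E) : E :=
  (gamma *: (z - prox_point g h r dh gamma z))%R.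

End difference_of_convex.

Section probability.
Context (R : realType).

(* Measurability for the Borel sigma-algebra of R^d. *)
Definition random_vector (d : nat) (dS : measure_display)
    (S : measurableType dS) (X : S -> 'rV[R]_d) : Prop :=
  measurable_fun [set: S] (X : S -> g_sigma_algebraType (@open 'rV[R]_d)).

Definition independent (d1 d2 d3 : measure_display) (Omega : measurableType d1)
    (S : measurableType d2) (T : measurableType d3) (P : probability Omega R)
    (X : Omega -> S) (Y : Omega -> T) : Prop :=
  forall (A : set S) (B : set T), measurable A -> measurable B ->
    P (X @^-1` A `&` Y @^-1` B) = (P (X @^-1` A) * P (Y @^-1` B))%E.

Definition uniform_index (d1 : measure_display) (Omega : measurableType d1)
    (P : probability Omega R) (K : nat) (tau : Omega -> nat) : Prop :=
  [/\ measurable_fun [set: Omega] tau,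
      forall w, (1 <= tau w <= K)%N
    & forall k, (1 <= k <= K)%N -> P (tau @^-1` [set k]) = (K%:R^-1)%:E].

(* S is the space of random seeds of the algorithm: A k f s is its output at
   stage k when run on f with seed s, and X k s is the k-th iterate. A seed
   carries the randomness of all stages, each stage reading the part it needs. *)
Definition stagewise_run (d : nat) (S : Type)
    (A : nat -> ('rV[R]_d -> \bar R) -> S -> 'rV[R]_d)
    (Fmodel : 'rV[R]_d -> 'rV[R]_d -> \bar R) (x1 : 'rV[R]_d) (K : nat)
    (X : nat -> S -> 'rV[R]_d) : Prop :=
  (forall s, X 1%N s = x1) /\
  (forall k s, (1 <= k <= K)%N -> X k.+1 s = A k (Fmodel (X k s)) s).

End probability.

(* Main.v *)
(* With I(z) the minimum of the model F_z^gamma, put U(z) = F(z) - I(z). Strong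
   convexity of the model at its minimizer P(z), evaluated at z where the model
   equals F, gives ||G(z)||^2 <= 2 gamma U(z). The subgradient inequality makes
   the model a majorant of F, so U(x_k) + F(x_(k+1)) <= F(x_k) + eps_k, with
   eps_k the suboptimality of the k-th stage. Taking expectations and summing
   over k bounds the sum of the E U(x_k) by Delta + c (1 + log K), and the
   independence of tau turns E U(x_tau) into the average of the E U(x_k).
   Everything stays in the extended reals, since F(x_k) may be infinite on a
   null set; the integral of z |-> ||G(z)||^2 is only bounded from above, so the
   measurability of P is not needed, but that of I is: I is an infimum over a
   countable family of points. *)
Require Import Defs.
From HB Require Import structures.
From mathcomp Require Import all_boot all_order all_algebra.
From mathcomp Require Import all_classical all_reals all_analysis.
From mathcomp Require Import measurable_realfun.
From mathcomp Require Import ring lra.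

Set Implicit Arguments.
Unset Strict Implicit.
Unset Printing Implicit Defensive.

Import Order.TTheory GRing.Theory Num.Theory.
Import numFieldNormedType.Exports.

Local Open Scope classical_set_scope.
Local Open Scope ring_scope.

(** * Algebra and continuity of the Euclidean inner product *)

Section euclidean.
Context (R : realType) (d : nat).
Implicit Types (u v w x y z : 'rV[R]_d) (t : R).

Lemma dotvv_ge0 u : 0 <= dotv u u.
Proof. by apply: sumr_ge0 => i _; rewrite -expr2 sqr_ge0. Qed.

Lemma enorm_sqr u : enorm u ^+ 2 = dotv u u.
Proof. by rewrite sqr_sqrtr // dotvv_ge0. Qed.

Lemma enormZ_sqr t u : enorm (t *: u) ^+ 2 = t ^+ 2 * enorm u ^+ 2.
Proof.
rewrite !enorm_sqr /dotv mulr_sumr; apply: eq_bigr => i _.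
by rewrite !mxE; ring.
Qed.

Lemma enorm0 : enorm (0 : 'rV[R]_d) = 0.
Proof. by rewrite /enorm /dotv big1 ?sqrtr0 // => i _; rewrite mxE mul0r. Qed.

Lemma dotv0 u : dotv u 0 = 0.
Proof. by rewrite /dotv big1 // => i _; rewrite mxE mulr0. Qed.

Lemma coord_sqr_le u i : u 0 i ^+ 2 <= enorm u ^+ 2.
Proof.
rewrite enorm_sqr /dotv (bigD1 i) //= -expr2 lerDl.
by apply: sumr_ge0 => j _; rewrite -expr2 sqr_ge0.
Qed.

Lemma dotv_conv v x y z t :
  dotv v (t *: x + (1 - t) *: y - z) =
  t * dotv v (x - z) + (1 - t) * dotv v (y - z).
Proof.
rewrite /dotv !mulr_sumr -big_split; apply: eq_bigr => i _ /=.
by rewrite !mxE; ring.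
Qed.

(** Being an exact identity, it supplies the negative term that turns convexity of the model into
    strong convexity. *)
Lemma enorm_sqr_conv x y z t :
  enorm (t *: x + (1 - t) *: y - z) ^+ 2 =
  t * enorm (x - z) ^+ 2 + (1 - t) * enorm (y - z) ^+ 2
  - t * (1 - t) * enorm (x - y) ^+ 2.
Proof.
rewrite !enorm_sqr /dotv !mulr_sumr -big_split -sumrB.
by apply: eq_bigr => i _ /=; rewrite !mxE; ring.
Qed.

Lemma continuous_dotv (f g : 'rV[R]_d -> 'rV[R]_d) :
  continuous f -> continuous g -> continuous (fun x => dotv (f x) (g x)).
Proof.
move=> cf cg; rewrite /dotv; apply: continuous_big.
  by move=> z; exact: add_continuous.
move=> i _ x.
have cc (k : 'rV[R]_d -> 'rV[R]_d) : continuous k -> {for x, continuous (fun y => k y 0 i)}.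
  move=> ck; apply: (@continuous_comp _ _ _ k (fun u : 'rV[R]_d => u 0 i)).
    exact: ck.
  exact: (@coord_continuous R 1 d 0 i).
exact: cvgM (cc f cf) (cc g cg).
Qed.

End euclidean.

(** * Lower semicontinuity and attainment of infima *)

Section lower_semicontinuity.
Context (R : realType) (T : topologicalType).
Local Open Scope ereal_scope.

Lemma lower_semicontinuousD (f g : T -> \bar R) :
  (forall x, f x != -oo) -> (forall x, g x != -oo) ->
  lower_semicontinuous f -> lower_semicontinuous g ->
  lower_semicontinuous (f \+ g).
Proof.
move=> fNy gNy lf lg x a /= afg.
have [b [b' [bf b'g abb']]] : exists b b', [/\ b%:E < f x, b'%:E < g x &
    (a <= b + b')%R].
  have below (e : \bar R) : e != -oo -> exists b, b%:E < e.
    case: e => [e _||//]; first by exists (e - 1)%R; rewrite lte_fin ltrBlDr ltrDl.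
    by exists 0%R; rewrite ltry.
  have [b0 b0f] := below _ (fNy x).
  have [b0' b0'g] := below _ (gNy x).
  (* Two finite summands share the slack [u + v - a] equally; a summand equal to [+oo] absorbs
     whatever the other leaves. *)
  move: afg b0f b0'g (fNy x) (gNy x).
  case: (f x) => [u||//]; case: (g x) => [v||//]; rewrite ?lte_fin => afg b0f b0'g _ _.
  - exists (u - (u + v - a) / 2)%R, (v - (u + v - a) / 2)%R.
    by rewrite !lte_fin; split; lra.
  - exists b0, (a - b0)%R; rewrite ltry lte_fin; split => //; lra.
  - exists (a - b0')%R, b0'; rewrite ltry lte_fin; split => //; lra.
  - exists 0%R, a; rewrite !ltry; split => //; lra.
have [V xV Vf] := lf _ _ bf; have [W xW Wg] := lg _ _ b'g.
exists (V `&` W); first exact: filterI.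
move=> y [/Vf bfy /Wg bgy]; apply: (@le_lt_trans _ _ (b + b')%:E).
  by rewrite lee_fin.
by rewrite EFinD; apply: lteD.
Qed.

Lemma continuous_lower_semicontinuous (f : T -> R) :
  continuous f -> lower_semicontinuous (EFin \o f).
Proof.
move=> cf x a /=; rewrite lte_fin => afx.
exists [set y | (a < f y)%R]; last by move=> y; rewrite lte_fin.
by move: (cf x) => /cvgrPdist_lt /(_ (f x - a)%R); rewrite subr_gt0 => /(_ afx);
  apply: filterS => y; rewrite ltr_distlC => /andP[+ _]; rewrite opprB addrCA subrr addr0.
Qed.

(* A minimizing sequence stays in a compact set; lower semicontinuity makes any
   cluster point a minimizer. *)
Lemma lsc_argmin_compact (f : T -> \bar R) (i b : R) (C : set T) :
  lower_semicontinuous f -> compact C ->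
  ereal_inf (range f) = i%:E -> (i < b)%R -> [set x | f x < b%:E] `<=` C ->
  exists p, f p = i%:E.
Proof.
move=> lf cC infi ib fbC.
(* The cap [b - i] keeps the whole minimizing sequence in the sublevel set inside [C]; the other
   bound drives its values to [i]. *)
pose e n : R := (Num.min (b - i) n.+1%:R^-1)%R.
have e_gt0 n : (0 < e n)%R by rewrite /e lt_min subr_gt0 ib invr_gt0 ltr0n.
have fmin n : exists x, f x < i%:E + (e n)%:E.
  have [|_ [x _ <-]] := @lb_ereal_inf_adherent _ (range f) _ (e_gt0 n).
    by rewrite infi.
  by rewrite infi => fx; exists x.
pose u n := projT1 (cid (fmin n)).
have fu n : f (u n) < i%:E + (e n)%:E := projT2 (cid (fmin n)).
have uC : (u @ \oo) C.
  exists 0%N => // n _; apply: fbC => /=; apply: (lt_le_trans (fu n)).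
  by rewrite -EFinD lee_fin -lerBrDl /e ge_min lexx.
have [p [_ clp]] := cC _ _ uC.
exists p; apply/eqP; rewrite eq_le; apply/andP; split; last first.
  by rewrite -infi; apply: ereal_inf_lbound; exists p.
(* If [f p] exceeded [i + r], so would [f] on a neighbourhood of [p], while the sequence eventually
   has values at most [i + r]. *)
apply/lee_addgt0Pr => r r0; rewrite leNgt; apply/negP => ifp.
have [V pV Vf] := lf p (i + r)%R ifp.
have : (u @ \oo) [set x | f x <= (i + r)%:E].
  have := near_infty_natSinv_lt (PosNum r0); apply: filterS => n /= /ltW nr.
  apply: (le_trans (ltW (fu n))); rewrite -EFinD lee_fin lerD2l.
  by rewrite /e ge_min nr orbT.
by move=> /clp /(_ pV) [x [/= fx /Vf]]; rewrite ltNge fx.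
Qed.

End lower_semicontinuity.

(** * Deterministic analysis of the proximal model *)

Section proximal_model.
Context (R : realType) (d : nat).
Local Notation E := 'rV[R]_d.
Context (g h : E -> R) (r : E -> \bar R) (dh : E -> E) (gamma m : R).
Context (g_lsc : lower_semicontinuous (fun x => (g x)%:E)).
Context (g_convex : convex_function [set: convex_lmodType E] g).
Context (r_proper : eproper r) (r_lsc : lower_semicontinuous r).
Context (r_convex : econvex r).
Context (dh_subgrad : forall z, subdifferential h z (dh z)).
Context (gamma_gt0 : 0 < gamma).
Local Open Scope ereal_scope.
Context (m_le : forall x, m%:E <= objective g h r x).

Local Notation phi x := ((g x)%:E + r x).
Local Notation F := (objective g h r).
Local Notation M := (model g h r dh gamma).
Local Notation q z x :=
  (gamma / 2 * enorm (x - z) ^+ 2 - (h z + dotv (dh z) (x - z)))%R.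

(** Separates [phi], which may be infinite, from a part that is finite and continuous in [x]. *)
Lemma modelE z x : M z x = phi x + (q z x)%:E.
Proof. by rewrite /model EFinB -addeA (addeC (- _)). Qed.

Lemma continuous_model_smooth_part (z : E) : continuous (fun x : E => q z x : R).
Proof.
have cB : continuous (fun x : E => x - z)%R.
  by move=> x; exact: cvgB (@cvg_id _ _) (@cst_continuous E E z x).
rewrite (_ : (fun x => _) = (fun x => gamma / 2 * dotv (x - z) (x - z) -
  (h z + dotv (dh z) (x - z)))%R); last by apply/funext => x; rewrite enorm_sqr.
have c1 := continuous_dotv cB cB.
have c2 := continuous_dotv (@cst_continuous E E (dh z)) cB.
move=> x; exact: cvgB (cvgM (@cst_continuous E R (gamma / 2)%R x) (c1 x))
  (cvgD (@cst_continuous E R (h z) x) (c2 x)).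
Qed.

Lemma model_diag z : M z z = F z.
Proof. by rewrite /model subrr dotv0 enorm0 expr0n mulr0 adde0 addr0. Qed.

Lemma objective_le_model z x :
  F x + (gamma / 2 * enorm (x - z) ^+ 2)%:E <= M z x.
Proof.
rewrite leeD2r // leeB // lee_fin; exact: dh_subgrad.
Qed.

(** Coercivity: sublevel sets of the model are bounded and its infimum is not [-oo]. *)
Lemma model_ge z x : (m + gamma / 2 * enorm (x - z) ^+ 2)%:E <= M z x.
Proof.
apply: le_trans (objective_le_model z x).
by rewrite EFinD leeD2r.
Qed.

Lemma phi_neqNy x : phi x != -oo.
Proof. by rewrite adde_eq_ninfty negb_or (proj1 r_proper). Qed.

Lemma model_lsc z : lower_semicontinuous (M z).
Proof.
rewrite (_ : M z = (fun x => phi x) \+ (EFin \o (fun x => q z x))); last first.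
  by apply/funext => x; rewrite modelE.
apply: lower_semicontinuousD => //.
- exact: phi_neqNy.
- by apply: lower_semicontinuousD => //; exact: (proj1 r_proper).
- exact/continuous_lower_semicontinuous/continuous_model_smooth_part.
Qed.

Lemma model_strongly_convex z x y a b (t : R) : (0 <= t <= 1)%R ->
  M z x = a%:E -> M z y = b%:E ->
  M z (t *: x + (1 - t) *: y)%R <=
  (t * a + (1 - t) * b - gamma / 2 * (t * (1 - t)) * enorm (x - y) ^+ 2)%:E.
Proof.
move=> t01; have /andP[t0 t1] := t01; rewrite !modelE.
have gc : (g (t *: x + (1 - t) *: y) <= t * g x + (1 - t) * g y)%R.
  by have := g_convex (Itv01 t0 t1) (in_setT x) (in_setT y).
have := r_convex x y t01.
move: (proj1 r_proper x) (proj1 r_proper y).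
case: (r x) => [rx||//]; case: (r y) => [ry||//] //= _ _ rc [<-] [<-].
apply: (@le_trans _ _ ((t * g x + (1 - t) * g y)%:E +
  (t * rx + (1 - t) * ry)%:E + (q z (t *: x + (1 - t) *: y))%:E)).
  rewrite leeD2r// leeD ?lee_fin//.
rewrite -!EFinD lee_fin dotv_conv enorm_sqr_conv; lra.
Qed.

(** Properness bounds the infimum above, coercivity bounds it below, and lower semicontinuity on a
    compact box gives attainment. *)
Lemma ereal_inf_modelP z :
  exists2 i : R, ereal_inf (range (M z)) = i%:E & exists p, M z p = i%:E.
Proof.
have [x0 x0d] := proj2 r_proper.
have infge : m%:E <= ereal_inf (range (M z)).
  apply: le_ereal_inf_tmp => _ [x _ <-]; apply: le_trans (model_ge z x).
  by rewrite lee_fin lerDl mulr_ge0 ?sqr_ge0// divr_ge0// ltW.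
have infle : ereal_inf (range (M z)) < +oo.
  apply: (@le_lt_trans _ _ (M z x0)); first by apply: ereal_inf_lbound; exists x0.
  rewrite modelE lte_add_pinfty ?ltry// lte_add_pinfty ?ltry//.
case infi: (ereal_inf (range (M z))) infge infle => [i| |] // infge _.
exists i => //.
(* By [model_ge], a model value below [i + 1] bounds the squared distance to [z] by
   [(i + 1 - m) / (gamma / 2)]. Adding 1 to this bound gives a half-width that avoids a square
   root. *)
apply: (@lsc_argmin_compact R _ (M z) i (i + 1)
   [set x : E | forall k, (`[z 0 k - (1 + (i + 1 - m) / (gamma / 2)),
     z 0 k + (1 + (i + 1 - m) / (gamma / 2))]%classic (x ord0 k))%R]) => //.
- exact: model_lsc.
- apply: (@rV_compact _ _ (fun k => `[z 0 k - (1 + (i + 1 - m) / (gamma / 2)),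
     z 0 k + (1 + (i + 1 - m) / (gamma / 2))]%classic)%R) => k.
  exact: segment_compact.
- by rewrite ltrDl.
- move=> x /= Mx k.
  have := le_lt_trans (model_ge z x) Mx; rewrite lte_fin => /ltW qle.
  have : (enorm (x - z) ^+ 2 <= (i + 1 - m) / (gamma / 2))%R.
    by rewrite ler_pdivlMr ?divr_gt0//; lra.
  move=> /(le_trans (coord_sqr_le _ k)); rewrite !mxE in_itv/=.
  set c := (_ / (gamma / 2))%R; set v := z 0%R k; set w := x 0%R k => cle.
  (* With [s = w - v], the squares of [s - 1] and [s + 1] give [2 |s| <= s ^ 2 + 1 <= c + 1], and
     [c >= 0]. *)
  have := sqr_ge0 (w - v)%R; have := sqr_ge0 (w - v - 1)%R.
  by have := sqr_ge0 (w - v + 1)%R => *; apply/andP; split; nra.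
Qed.

(** As a minimizer exists, [xget] returns one and not its default value. *)
Lemma prox_point_model z : M z (prox_point g h r dh gamma z) =
  ereal_inf (range (M z)).
Proof.
have [i infi [p pi]] := ereal_inf_modelP z.
have pmin : argmin (M z) p.
  by move=> x; rewrite pi -infi; apply: ereal_inf_lbound; exists x.
apply/eqP; rewrite eq_le; apply/andP; split; last first.
  by apply: ereal_inf_lbound; exists (prox_point g h r dh gamma z).
by rewrite infi -pi; apply: (xgetI 0%R pmin).
Qed.

(* Letting [t] tend to 0 in the strong convexity inequality at the minimizer. *)
Lemma model_quadratic_growth z x :
  ereal_inf (range (M z)) +
    (gamma / 2 * enorm (x - prox_point g h r dh gamma z) ^+ 2)%:E <= M z x.
Proof.
set p := prox_point _ _ _ _ _ _.
have [i infi _] := ereal_inf_modelP z.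
have Mp : M z p = i%:E by rewrite prox_point_model.
rewrite infi -EFinD.
case Mx : (M z x) => [a| |]; [|by rewrite leey|]; last first.
  by have := model_ge z x; rewrite Mx.
rewrite lee_fin leNgt; apply/negP; set D := (gamma / 2 * _)%R => aD.
have ia : (i <= a)%R by rewrite -lee_fin -Mx -infi; apply: ereal_inf_lbound; exists x.
have D0 : (0 < D)%R by lra.
(* This [t] puts [(1 - t) * D] halfway between [a - i] and [D], hence strictly above [a - i], so the
   model would fall below its infimum [i] at the convex combination. *)
pose t := ((D - (a - i)) / (2 * D))%R.
have tD : (t * (2 * D) = D - (a - i))%R by rewrite /t divfK//; apply: lt0r_neq0; lra.
have t0 : (0 < t)%R by apply: divr_gt0; lra.
have t1 : (t <= 1)%R by rewrite /t ler_pdivrMr; lra.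
have t01 : (0 <= t <= 1)%R by rewrite ltW.
have := model_strongly_convex t01 Mx Mp.
apply/negP; rewrite -ltNge; apply: (@lt_le_trans _ _ i%:E); last first.
  by rewrite -infi; apply: ereal_inf_lbound; eexists.
rewrite lte_fin (_ : gamma / 2 * _ * _ = t * (1 - t) * D)%R; last by rewrite /D; ring.
suff : (0 < t * (i - a + (1 - t) * D))%R by lra.
by rewrite mulr_gt0//; lra.
Qed.

Lemma prox_grad_le z :
  (enorm (prox_grad g h r dh gamma z) ^+ 2)%:E <=
  (2 * gamma)%:E * (F z - ereal_inf (range (M z))).
Proof.
have := model_quadratic_growth z z; rewrite model_diag /prox_grad enormZ_sqr.
have [i -> _] := ereal_inf_modelP z.
move: (m_le z); case: (F z) => [a _| _ _|//]; last first.
  by rewrite gt0_muley ?leey// lte_fin mulr_gt0.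
rewrite -!EFinD !lee_fin -subr_ge0 => ia; rewrite -subr_ge0.
set e := enorm _ in ia *.
suff -> : (2 * gamma * (a - i) - gamma ^+ 2 * e ^+ 2 =
   2 * gamma * (a - (i + gamma / 2 * e ^+ 2)))%R by rewrite !mulr_ge0// ltW.
by field.
Qed.

Lemma model_gap_ge0 z x : 0 <= M z x - ereal_inf (range (M z)).
Proof.
have [i infi _] := ereal_inf_modelP z; rewrite infi leeBrDr// add0e -infi.
by apply: ereal_inf_lbound; exists x.
Qed.

(** The shift by [m] makes every term nonnegative and the additive form avoids [oo - oo], so that
    both sides can be integrated term by term. *)
Lemma stage_descent z y :
  (F z - ereal_inf (range (M z))) + (F y - m%:E) <=
  (F z - m%:E) + (M z y - ereal_inf (range (M z))).
Proof.
have [i infi _] := ereal_inf_modelP z; rewrite infi.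
have : F y <= M z y.
  apply: le_trans (objective_le_model z y).
  by rewrite leeDl// lee_fin mulr_ge0 ?sqr_ge0// divr_ge0// ltW.
move: (m_le y) (m_le z).
case: (F z) => [a| |]//; case: (F y) => [b| |]//; case: (M z y) => [c| |]//=;
  rewrite ?leey // !lee_fin => *; lra.
Qed.

End proximal_model.

(** * Borel measurability of functions of random vectors *)

Section random_vectors.
Context (R : realType) (d : nat) (dS : measure_display) (S : measurableType dS).
Implicit Types X Y : S -> 'rV[R]_d.

(** The rays []a, +oo]] generate the Borel sets of the extended reals, and lower semicontinuity
    makes their preimages under [f] open. *)
Lemma measurable_lsc_random_vector X (f : 'rV[R]_d -> \bar R) :
  random_vector X -> lower_semicontinuous f ->
  measurable_fun [set: S] (f \o X).
Proof.
move=> mX lf; apply: (measurability _ (ErealGenOInfty.measurableE R)) => //.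
move=> _ [_ [a ->] <-]; rewrite setTI.
have := mX measurableT [set x | (a%:E < f x)%E].
rewrite setTI (_ : X @^-1` _ = (f \o X) @^-1` `]a%:E, +oo[%classic).
  by apply; apply: sub_sigma_algebra; exact: (proj1 (lower_semicontinuousP f) lf a).
by apply/seteqP; split => s /=; rewrite in_itv /= andbT.
Qed.

Lemma measurable_coord_random_vector X i :
  random_vector X -> measurable_fun [set: S] (fun s => X s 0 i).
Proof.
move=> mX; apply/measurable_EFinP.
apply: (measurable_lsc_random_vector (f := fun x => (x 0 i)%:E)) => //.
apply: (continuous_lower_semicontinuous (f := fun x : 'rV[R]_d => x 0 i)).
exact: coord_continuous.
Qed.

Lemma measurable_dotv X Y :
  (forall i, measurable_fun [set: S] (fun s => X s 0 i)) ->
  (forall i, measurable_fun [set: S] (fun s => Y s 0 i)) ->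
  measurable_fun [set: S] (fun s => dotv (X s) (Y s)).
Proof.
by move=> mX mY; apply: measurable_sum => i; exact: measurable_funM.
Qed.

Lemma measurable_coordB X Y i : random_vector X -> random_vector Y ->
  measurable_fun [set: S] (fun s => (X s - Y s) 0 i).
Proof.
move=> mX mY; under eq_fun do rewrite !mxE.
by apply: measurable_funB; exact: measurable_coord_random_vector.
Qed.

Lemma random_vector_cst (x : 'rV[R]_d) : random_vector (fun _ : S => x).
Proof. exact: measurable_cst. Qed.

End random_vectors.

(* A countable family whose graph points are dense in the graph of [f] is
   obtained by choosing, for each rational box and each rational level, a point
   of the box below that level. *)
Lemma countable_inf_family (R : realType) (d : nat) (f : 'rV[R]_d -> \bar R) :
  exists y : 'rV[rat]_d * rat * rat -> 'rV[R]_d,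
    forall (l : 'rV[R]_d -> R) (b : R), continuous l ->
    (exists x, (f x + (l x)%:E < b%:E)%E) ->
    exists k, (f (y k) + (l (y k))%:E < b%:E)%E.
Proof.
pose Q (k : 'rV[rat]_d * rat * rat) := [set x : 'rV[R]_d |
  (forall i, `|ratr (k.1.1 0 i) - x 0 i| < ratr k.1.2) /\ (f x < (ratr k.2)%:E)%E].
exists (fun k => xget 0 (Q k)) => l b cl [x fxb].
(* Splitting [b] decouples the two terms: [f] is controlled by a rational level below [c], [l] by
   continuity at [x]. *)
have [c [c' [fc lc cc']]] : exists c c', [/\ (f x < c%:E)%E, l x < c' & c + c' <= b].
  move: fxb; case: (f x) => [u|//|_].
    rewrite lte_fin => fxb; exists (u + (b - (u + l x)) / 2), (l x + (b - (u + l x)) / 2).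
    by rewrite !lte_fin; split; lra.
  by exists (b - (l x + 1)), (l x + 1); rewrite ltNyr; split => //; lra.
have [a fa ac] : exists2 a : rat, (f x < (ratr a)%:E)%E & ratr a < c.
  move: fc; case: (f x) => [u|//|_].
    rewrite lte_fin => /rat_in_itvoo[a]; rewrite in_itv /= => /andP[ua ac].
    by exists a => //; rewrite lte_fin.
  have /rat_in_itvoo[a] : c - 1 < c by lra.
  by rewrite in_itv /= => /andP[_ ac]; exists a => //; rewrite ltNyr.
have : nbhs x [set y | l y < c'].
  have := cl x; move=> /cvgrPdist_lt /(_ (c' - l x)); rewrite subr_gt0 => /(_ lc).
  by apply: filterS => y; rewrite ltr_distlC => /andP[_]; rewrite addrCA subrr addr0.
rewrite -nbhs_ballE => -[e /= e0 xe].
(* Half the radius: both [x] and the chosen point lie within [del] of the rational centre, hence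
   within [e] of each other. *)
have /rat_in_itvoo[del] : 0 < e / 2 by rewrite divr_gt0.
rewrite in_itv /= => /andP[del0 dele].
have qP i : exists q : rat, `|ratr q - x 0 i| < ratr del.
  have /rat_in_itvoo[q] : x 0 i - ratr del < x 0 i + ratr del by lra.
  by rewrite in_itv /= => qx; exists q; rewrite ltr_distl.
pose k := ((\row_i projT1 (cid (qP i)) : 'rV[rat]_d), del, a).
have Qx : Q k x.
  by split => //= i; rewrite mxE; exact: (projT2 (cid (qP i))).
exists k; have [/= near_k fk] := xgetI 0 Qx.
have lk : l (xget 0 (Q k)) < c'.
  apply: xe; split => // i j; rewrite (ord1 i) /ball /=.
  apply: (@le_lt_trans _ _ (`|x 0 j - ratr (k.1.1 0 j)| +
    `|ratr (k.1.1 0 j) - xget 0 (Q k) 0 j|)); first exact: ler_distD.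
  rewrite (distrC (x 0 j)); have /= := proj1 Qx j; have := near_k j; lra.
apply: (@lt_le_trans _ _ (c%:E + c'%:E)%E); last by rewrite -EFinD lee_fin.
by apply: lteD; [apply: (lt_trans fk); rewrite lte_fin|rewrite lte_fin].
Qed.

(** * Measurability of the objective, the model and its infimum *)

Section model_measurability.
Context (R : realType) (d : nat) (dS : measure_display) (S : measurableType dS).
Local Notation E := 'rV[R]_d.
Context (g h : E -> R) (r : E -> \bar R) (dh : E -> E) (gamma : R).
Context (g_lsc : lower_semicontinuous (fun x => (g x)%:E)).
Context (h_lsc : lower_semicontinuous (fun x => (h x)%:E)).
Context (r_lsc : lower_semicontinuous r).
Context (X : S -> E) (mX : random_vector X).
Local Open Scope ereal_scope.

Lemma measurable_objective :
  measurable_fun [set: S] (objective g h r \o X).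
Proof.
apply: emeasurable_funB; last exact: (measurable_lsc_random_vector mX h_lsc).
by apply: emeasurable_funD; [exact: (measurable_lsc_random_vector mX g_lsc)|
  exact: measurable_lsc_random_vector].
Qed.

Context (mdhX : random_vector (fun s => dh (X s))).

Lemma measurable_model (Y : S -> E) : random_vector Y ->
  measurable_fun [set: S] (fun s => model g h r dh gamma (X s) (Y s)).
Proof.
move=> mY; have mYX i := measurable_coordB i mY mX.
apply: emeasurable_funD.
  apply: emeasurable_funB.
    by apply: emeasurable_funD; [exact: (measurable_lsc_random_vector mY g_lsc)|
      exact: measurable_lsc_random_vector].
  apply/measurable_EFinP; apply: measurable_funD.
    apply/measurable_EFinP; exact: (measurable_lsc_random_vector mX h_lsc).
  apply: measurable_dotv => // i; exact: measurable_coord_random_vector.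
apply/measurable_EFinP; apply: measurable_funM => //.
under eq_fun do rewrite enorm_sqr.
exact: measurable_dotv.
Qed.

(** The infimum is below [b] exactly when the model is below [b] at some point of a countable
    family. The family is built from [phi] alone, so it serves all [s] at once: only the continuous
    part of the model depends on [X s]. *)
Lemma measurable_ereal_inf_model : measurable_fun [set: S]
  (fun s => ereal_inf (range (model g h r dh gamma (X s)))).
Proof.
have [y yP] := countable_inf_family (fun x => (g x)%:E + r x).
apply: (measurability _ (ErealGenInftyO.measurableE R)) => //.
move=> _ [_ [b ->] <-]; rewrite setTI.
rewrite (_ : _ @^-1` _ =
    \bigcup_k [set s | model g h r dh gamma (X s) (y k) < b%:E]); last first.
  apply/seteqP; split => s /=; rewrite in_itv /=.
    move=> /ereal_inf_lt[_ [x _ <-] Mxb].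
    have [|k] := yP _ b (@continuous_model_smooth_part _ _ h dh gamma (X s)).
      by exists x; rewrite -modelE.
    by rewrite -modelE => Mk; exists k.
  move=> [k _ /= Mk]; apply: (le_lt_trans _ Mk).
  by apply: ereal_inf_lbound; exists (y k).
apply: countable_bigcupT_measurable => // k.
rewrite -[X in measurable X]setTI.
by apply: emeasurable_fun_infty_o => //; apply: measurable_model; exact: random_vector_cst.
Qed.

End model_measurability.

(** * Integration and independence *)

Section integration.
Context (R : realType) (dO dS : measure_display).
Context (Omega : measurableType dO) (S : measurableType dS).
Local Open Scope ereal_scope.

(* Unlike [ge0_le_integral], this does not need measurability: the integral of a
   nonnegative function is a supremum over the simple functions below it. *)
Lemma le_integral_nonmeasurable (mu : {measure set Omega -> \bar R})
    (f1 f2 : Omega -> \bar R) :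
  (forall w, 0 <= f1 w) -> (forall w, f1 w <= f2 w) ->
  \int[mu]_w f1 w <= \int[mu]_w f2 w.
Proof.
move=> f10 f12; rewrite !ge0_integralTE//; last first.
  by move=> w; exact: le_trans (f12 w).
apply: ereal_sup_le => _ [s /= sf1 <-].
by exists s => //= w; exact: le_trans (f12 w).
Qed.

(** The complement of [B] is null for the restricted measure, which agrees with [mu] inside [B]. *)
Lemma integral_mrestr (mu : {measure set Omega -> \bar R}) (B : set Omega)
    (mB : measurable B) (f : Omega -> \bar R) :
  measurable_fun [set: Omega] f -> (forall w, 0 <= f w) ->
  \int[mrestr mu mB]_w f w = \int[mu]_(w in B) f w.
Proof.
move=> mf f0; rewrite [LHS](ge0_negligible_integral (N := ~` B))//=.
- rewrite setTD setCK; apply: eq_measure_integral => C _ CB.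
  by rewrite /= /mrestr setIidl.
- exact: measurableC.
- by rewrite /mrestr setICl measure0.
Qed.

(** Independence says that the image under [xi] of [P] restricted to [B] is [p] times the image of
    [P]; integrating [u] against both gives the claim. *)
Lemma integral_indep (P : probability Omega R) (xi : Omega -> S)
    (B : set Omega) (p : R) (u : S -> \bar R) :
  measurable_fun [set: Omega] xi -> measurable B -> (0 <= p)%R ->
  (forall C, measurable C -> P (xi @^-1` C `&` B) = P (xi @^-1` C) * p%:E) ->
  measurable_fun [set: S] u -> (forall s, 0 <= u s) ->
  \int[P]_(w in B) u (xi w) = p%:E * \int[P]_w u (xi w).
Proof.
move=> mxi mB p0 indep mu u0.
have muxi : measurable_fun [set: Omega] (u \o xi) by exact: measurableT_comp.
pose push (m : {measure set Omega -> \bar R}) : {measure set S -> \bar R} :=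
  measure_function_pushforward__canonical__measure_function_Measure m mxi.
have integral_push m : \int[push m]_s u s = \int[m]_w u (xi w).
  by rewrite ge0_integral_pushforward.
rewrite -(integral_mrestr P mB muxi) => [|w]; last exact: u0.
rewrite -!integral_push.
transitivity (\int[mscale (NngNum p0) (push P)]_s u s).
  apply: eq_measure_integral => C mC _.
  by rewrite /= /pushforward /mscale /mrestr /= indep// muleC.
by rewrite ge0_integral_mscale.
Qed.

End integration.

(** * Harmonic sums and telescoping *)

(** Induction: [ln (1 + x) <= x] at [x = - 1 / (n + 2)] bounds the new term [1 / (n + 2)] by
    [ln (n + 2) - ln (n + 1)]. *)
Lemma harmonic_le_ln (R : realType) (n : nat) :
  \sum_(1 <= k < n.+2) k%:R^-1 <= 1 + ln n.+1%:R :> R.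
Proof.
elim: n => [|n IH]; first by rewrite big_nat1 invr1 ln1 addr0.
rewrite big_nat_recr//=; apply: (le_trans (lerD IH (lexx _))).
have n1 : (0 : R) < n.+1%:R by rewrite ltr0n.
have n2 : (0 : R) < n.+2%:R by rewrite ltr0n.
have n12 : (n.+2%:R : R) = n.+1%:R + 1 by rewrite -[in LHS]addn1 natrD.
have := @le_ln1Dx R (- n.+2%:R^-1).
rewrite (_ : 1 - n.+2%:R^-1 = n.+1%:R / n.+2%:R :> R); last first.
  apply: (mulIf (lt0r_neq0 n2)).
  by rewrite divfK ?lt0r_neq0// mulrBl mul1r mulVf ?lt0r_neq0// n12 addrK.
rewrite ln_div ?posrE// ltrN2 invf_lt1// ltr1n => /(_ isT).
by move: (ln n.+1%:R) (ln n.+2%:R) (n.+2%:R^-1) => a b v; lra.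
Qed.

(** The remainder [b n.+1] stays on the left, since subtracting it could be meaningless in the
    extended reals. *)
Lemma telescope_le (R : realDomainType) (a b : nat -> \bar R) (e : nat -> R)
    (D : \bar R) (K : nat) :
  (b 1%N <= D)%E ->
  (forall k, (1 <= k <= K)%N -> a k + b k.+1 <= b k + (e k)%:E)%E ->
  forall n, (n <= K)%N ->
  (\sum_(1 <= k < n.+1) a k + b n.+1 <= D + (\sum_(1 <= k < n.+1) e k)%:E)%E.
Proof.
move=> bD step; elim=> [_|n IH nK]; first by rewrite !big_geq// add0e adde0.
rewrite (big_nat_recr _ _ e)// (big_nat_recr _ _ a)//= EFinD [leRHS]addeA.
rewrite -[leLHS](addeA (\sum_(1 <= k < n.+1) a k)%E).
apply: (le_trans (leeD2l _ (step n.+1 nK))); rewrite addeA leeD2r//.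
exact/IH/ltnW.
Qed.

(** * The convergence rate of the stagewise method *)

Theorem theorem1 (R : realType) (d : nat)
  (g h : 'rV[R]_d -> R) (r : 'rV[R]_d -> \bar R)
  (g_lsc : lower_semicontinuous (fun x => (g x)%:E))
  (g_convex : convex_function [set: convex_lmodType 'rV[R]_d] g)
  (h_lsc : lower_semicontinuous (fun x => (h x)%:E))
  (h_convex : convex_function [set: convex_lmodType 'rV[R]_d] h)
  (r_proper : eproper r) (r_lsc : lower_semicontinuous r) (r_convex : econvex r)
  (dh : 'rV[R]_d -> 'rV[R]_d) (dh_subgrad : forall z, subdifferential h z (dh z))
  (Delta gamma c : R)
  (Delta_gt0 : 0 < Delta) (gamma_gt0 : 0 < gamma) (c_gt0 : 0 < c)
  (x1 : 'rV[R]_d) (x1_dom : edom r x1)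
  (x1_gap : (objective g h r x1 - ereal_inf (range (objective g h r))
             <= Delta%:E)%E)
  (K : nat) (K_gt0 : (0 < K)%N)
  (dO dS : measure_display)
  (Omega : measurableType dO) (S : measurableType dS) (P : probability Omega R)
  (xi : Omega -> S) (xi_meas : measurable_fun [set: Omega] xi)
  (A : nat -> ('rV[R]_d -> \bar R) -> S -> 'rV[R]_d)
  (X : nat -> S -> 'rV[R]_d)
  (X_run : stagewise_run A (model g h r dh gamma) x1 K X)
  (X_meas : forall k, (1 <= k <= K.+1)%N -> random_vector (X k))
  (dhX_meas : forall k, (1 <= k <= K)%N -> random_vector (fun s => dh (X k s)))
  (A_guarantee : forall k, (1 <= k <= K)%N ->
    (\int[P]_w (model g h r dh gamma (X k (xi w)) (X k.+1 (xi w))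
                - ereal_inf (range (model g h r dh gamma (X k (xi w)))))
     <= (c / k%:R)%:E)%E)
  (tau : Omega -> nat) (tau_unif : uniform_index P K tau)
  (tau_indep : independent P xi tau) :
  ('E_P[fun w => (enorm (prox_grad g h r dh gamma (X (tau w) (xi w))) ^+ 2)%R]
   <= (2 * gamma * Delta / K%:R
       + 2 * gamma * c * (1 + ln K%:R) / K%:R)%:E)%E.
Proof.
(* [m] is the infimum of the objective: finiteness at [x1] excludes [+oo], and the finite gap
   excludes [-oo]. *)
have [m m_le gap1] : exists2 m : R, forall x, (m%:E <= objective g h r x)%E &
    (objective g h r x1 - m%:E <= Delta%:E)%E.
  have F1 : (objective g h r x1 < +oo)%E.
    by rewrite /objective -EFinN lte_add_pinfty ?ltry// lte_add_pinfty ?ltry.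
  have infF x : (ereal_inf (range (objective g h r)) <= objective g h r x)%E.
    by apply: ereal_inf_lbound; exists x.
  move: x1_gap (infF); case: (ereal_inf _) => [m| |] gap infm.
  - by exists m.
  - by move: F1; rewrite ltNge (infm x1).
  - have : (objective g h r x1 != -oo)%E.
      by rewrite /objective -EFinN !adde_eq_ninfty !negb_or /= (proj1 r_proper).
    by move: gap F1; case: (objective g h r x1).
pose F := objective g h r.
pose M := model g h r dh gamma.
pose infM z := ereal_inf (range (M z)).
pose U k s := (F (X k s) - infM (X k s))%E.
pose eps k s := (M (X k s) (X k.+1 s) - infM (X k s))%E.
pose f k s := (F (X k s) - m%:E)%E.
have gap_ge0 := model_gap_ge0 g_lsc r_proper r_lsc dh_subgrad gamma_gt0 m_le.
have U_ge0 k s : (0 <= U k s)%E by rewrite /U /F -(model_diag g h r dh gamma); exact: gap_ge0.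
have eps_ge0 k s : (0 <= eps k s)%E by exact: gap_ge0.
have f_ge0 k s : (0 <= f k s)%E by rewrite /f leeBrDr// add0e.
have mF k : (1 <= k <= K.+1)%N -> measurable_fun [set: S] (fun s => F (X k s)).
  by move=> /X_meas; exact: measurable_objective.
have leKS k : (1 <= k <= K)%N -> (1 <= k <= K.+1)%N.
  by case/andP=> -> /leqW.
have minf k : (1 <= k <= K)%N -> measurable_fun [set: S] (fun s => infM (X k s)).
  move=> k1; apply: measurable_ereal_inf_model => //; first exact/X_meas/leKS.
  exact: dhX_meas.
have mU k : (1 <= k <= K)%N -> measurable_fun [set: S] (U k).
  by move=> k1; apply: emeasurable_funB; [exact/mF/leKS|exact: minf].
have meps k : (1 <= k <= K)%N -> measurable_fun [set: S] (eps k).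
  move=> k1; apply: emeasurable_funB; last exact: minf.
  apply: measurable_model => //; [exact/X_meas/leKS|exact: dhX_meas|].
  by apply: X_meas; case/andP: k1.
have mf k : (1 <= k <= K.+1)%N -> measurable_fun [set: S] (f k).
  by move=> k1; apply: emeasurable_funB => //; exact: mF.
have mxi (u : S -> \bar R) : measurable_fun [set: S] u ->
  measurable_fun [set: Omega] (u \o xi) by move=> mu; exact: measurableT_comp.
have step k : (1 <= k <= K)%N ->
    (\int[P]_w U k (xi w) + \int[P]_w f k.+1 (xi w) <=
     \int[P]_w f k (xi w) + (c / k%:R)%:E)%E.
  move=> k1; have k1' := leKS _ k1.
  have kS : (1 <= k.+1 <= K.+1)%N by case/andP: k1.
  apply: (@le_trans _ _ (\int[P]_w f k (xi w) + \int[P]_w eps k (xi w))%E); last first.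
    by rewrite leeD2l//; exact: A_guarantee.
  rewrite -!ge0_integralD//; try (by apply: mxi; auto).
  apply: le_integral_nonmeasurable => w; first by rewrite adde_ge0.
  exact: (stage_descent g_lsc r_proper r_lsc dh_subgrad gamma_gt0 m_le).
have f1 : (\int[P]_w f 1%N (xi w) <= Delta%:E)%E.
  (* The first iterate is the same for all seeds, so the integrand is constant and [P] has mass
     1. *)
  under eq_integral do rewrite /f (proj1 X_run).
  rewrite integral_cst//; apply: le_trans gap1.
  rewrite -[leRHS]mule1 le_eqVlt; apply/orP; left; apply/eqP.
  by congr (_ * _)%E; exact: probability_setT.
have sumU : (\sum_(1 <= k < K.+1) \int[P]_w U k (xi w) <=
    Delta%:E + (\sum_(1 <= k < K.+1) c / k%:R)%:E)%E.
  (* The leftover expectation of [f K.+1] is nonnegative and is dropped. *)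
  apply: le_trans (telescope_le f1 step (leqnn K)).
  by rewrite leeDl// integral_ge0.
have [mtau tauK tauP] := tau_unif.
pose B k := tau @^-1` [set k].
have mB k : measurable (B k) by rewrite -[B k]setTI; exact: mtau.
(* [U] at the random index is split over the values of [tau]; the ordinal [k] stands for stage
   [k + 1]. *)
pose V (k : 'I_K) := (U k.+1 \o xi) \_ (B k.+1).
have V_ge0 k w : (0 <= V k w)%E by rewrite /V patchE; case: ifP => // _; exact: U_ge0.
have mV k : measurable_fun [set: Omega] (V k).
  apply/(measurable_restrictT (U k.+1 \o xi) (mB k.+1)).
  by apply: measurable_funTS; apply: (mxi _ (mU k.+1 _)); rewrite /= ltn_ord.
have intV k : (\int[P]_w V k w = (K%:R^-1)%:E * \int[P]_w U k.+1 (xi w))%E.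
  have k1 : (1 <= k.+1 <= K)%N by rewrite /= ltn_ord.
  rewrite -integral_mkcond; apply: (integral_indep xi_meas _ _ _ (mU _ k1)) => //.
  by move=> C mC; rewrite -(tauP _ k1); exact: tau_indep.
have grad_le w : ((enorm (prox_grad g h r dh gamma (X (tau w) (xi w))) ^+ 2)%:E <=
    (2 * gamma)%:E * \sum_(k < K) V k w)%E.
  apply: (le_trans (prox_grad_le g_lsc g_convex r_proper r_lsc r_convex
    dh_subgrad gamma_gt0 m_le _)).
  apply: lee_wpmul2l; first by rewrite lee_fin mulr_ge0// ltW.
  have /andP[tau1 tau_le] := tauK w.
  have tauK' : ((tau w).-1 < K)%N by rewrite prednK.
  (* The term of index [tau w - 1] is the wanted gap, and the others are nonnegative. *)
  rewrite (bigD1 (Ordinal tauK'))//= {1}/V patchE /= prednK// mem_set//.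
  by rewrite leeDl// sume_ge0.
rewrite unlock; apply: (le_trans (le_integral_nonmeasurable P _ grad_le)).
  by move=> w; rewrite lee_fin sqr_ge0.
rewrite ge0_integralZl//; last 3 first.
- exact: emeasurable_sum.
- by move=> w _; exact: sume_ge0.
- by rewrite lee_fin mulr_ge0// ltW.
rewrite ge0_integral_sum//; under eq_bigr do rewrite intV.
rewrite -ge0_sume_distrr; last by move=> k _; apply: integral_ge0 => w _; exact: U_ge0.
have gK : 0 <= 2 * gamma / K%:R by rewrite !mulr_ge0 ?invr_ge0// ltW.
rewrite muleA -EFinM.
move: sumU; rewrite big_add1 big_mkord => sumU.
apply: (le_trans (lee_wpmul2l _ sumU)); first by rewrite lee_fin.
rewrite -mulr_sumr -EFinD -EFinM lee_fin.
rewrite (_ : _ + _ = 2 * gamma / K%:R * (Delta + c * (1 + ln K%:R))); last by ring.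
rewrite ler_wpM2l// lerD2l ler_pM2l//.
(* Positivity of [K] gives the form [n.+1] in which the harmonic bound is stated. *)
by move: K_gt0; case: (K) => // n _; exact: harmonic_le_ln.
Qed.
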